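(* Fix an integer $k\ge 2$ and a real number $E\ge 1$. Then, for $\mathbf{n}=(n_1,\dots,n_k)$ ranging over $\mathcal{C}^k_E$, $$|Q(k,\mathbf{n})|=\frac{n_1\cdots n_k}{\zeta(k)}+\mathcal{O}(f_k(\mathbf{n})),$$ where $\zeta$ is the Riemann zeta function.
   Context: For $\mathbf{n}=(n_1,\dots,n_k)\in\mathbb{R}^k$ with all $n_i\ge 1$, $Q(k,\mathbf{n})$ is the set of all relatively prime $k$-tuples $(a_1,\dots,a_k)$ of positive integers (i.e. $\gcd(a_1,\dots,a_k)=1$) with $a_i\le n_i$ for each $i$. The set $\mathcal{C}^k_E$ consists of all $\mathbf{n}\in\mathbb{R}^k$ with every $n_i\ge 1$ and $\max\{n_1,\dots,n_k\}/\min\{n_1,\dots,n_k\}\le E$. Let $\gamma(\mathbf{n})=(n_1\cdots n_k)^{1/k}$, and define $f_k(\mathbf{n})=\gamma(\mathbf{n})\ln(\gamma(\mathbf{n}))$ if $k=2$ and $f_k(\mathbf{n})=\gamma(\mathbf{n})^{k-1}$ if $k>2$. For real functions $F,F_1,g$ on $\mathcal{C}^k_E$ with $g>0$ outside some compact set, $F=F_1+\mathcal{O}(g)$ means that there are a constant $M$ and a compact set $C\subseteq\mathcal{C}^k_E$ with $|F(\mathbf{n})-F_1(\mathbf{n})|\le M g(\mathbf{n})$ for all $\mathbf{n}\in \mathcal{C}^k_E\setminus C$. (The constant may depend on $k$ and $E$.) *)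

(* Defs.v *)
From mathcomp Require Import all_boot all_order all_algebra finmap.
From mathcomp Require Import all_classical all_reals all_analysis.

Set Implicit Arguments.
Unset Strict Implicit.
Unset Printing Implicit Defensive.

Import Order.TTheory GRing.Theory Num.Theory.
Import numFieldNormedType.Exports.

Local Open Scope classical_set_scope.
Local Open Scope ring_scope.

Section Defs.
Context {R : realType}.

(* The unit 0 makes this the maximum of the entries only when one of them is
   nonnegative; it is used for vectors with entries >= 1. *)
Definition vmax (k : nat) (n : 'rV[R]_k) : R :=
  \big[Num.max/0]_(i < k) n ord0 i.

(* The unit vmax n is above all entries, so it does not affect the minimum
   when k > 0. *)
Definition vmin (k : nat) (n : 'rV[R]_k) : R :=
  \big[Num.min/vmax n]_(i < k) n ord0 i.

Definition CkE (k : nat) (E : R) : set 'rV[R]_k :=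
  [set n : 'rV[R]_k | (forall i : 'I_k, 1 <= n ord0 i) /\ vmax n / vmin n <= E].

Definition Q (k : nat) (n : 'rV[R]_k) : set {ffun 'I_k -> nat} :=
  [set a : {ffun 'I_k -> nat} | [/\ forall i, (0 < a i)%N,
               \big[gcdn/0%N]_(i < k) a i = 1%N &
               forall i, (a i)%:R <= n ord0 i]].

(* fset_set is the empty set on infinite sets, so cardQ is meaningful because
   of this fact. *)
Lemma finite_Q (k : nat) (n : 'rV[R]_k) : finite_set (Q n).
Proof.
pose N := (\max_(i < k) Num.truncn (n ord0 i))%N.
pose h (g : {ffun 'I_k -> 'I_N.+1}) : {ffun 'I_k -> nat} :=
  [ffun i => nat_of_ord (g i)].
apply: (@sub_finite_set _ _ (h @` setT)); last first.
  by apply: finite_image; exact: finite_finset.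
move=> a [_ _ an]; exists [ffun i => inord (a i)] => //.
apply/ffunP => i; rewrite !ffunE inordK// ltnS.
apply: leq_trans (@leq_bigmax _ (fun i => Num.truncn (n ord0 i)) i).
by rewrite truncn_ge_nat ?an// (le_trans _ (an i)).
Qed.

Definition cardQ (k : nat) (n : 'rV[R]_k) : nat := #|` fset_set (Q n)|%fset.

(* The series over m >= 1 of 1 / m `^ s, for real s > 1; riemannR s is indexed
   from 0. *)
Definition zeta (s : R) : R := limn (series (riemannR s)).

Definition gmean (k : nat) (n : 'rV[R]_k) : R :=
  (\prod_(i < k) n ord0 i) `^ (k%:R^-1).

Definition fk (k : nat) (n : 'rV[R]_k) : R :=
  if k == 2%N then gmean n * ln (gmean n) else gmean n ^+ k.-1.

(* F = F1 + O(g) on D, away from a compact subset of D. The first conjunct is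
   the requirement on g under which the notation is defined. *)
Definition bigO_on (k : nat) (D : set 'rV[R]_k) (F F1 g : 'rV[R]_k -> R) : Prop :=
  (exists K : set 'rV[R]_k,
     [/\ compact K, K `<=` D & forall n, (D `\` K) n -> 0 < g n]) /\
  (exists (M : R) (C : set 'rV[R]_k),
     [/\ compact C, C `<=` D &
         forall n, (D `\` C) n -> `|F n - F1 n| <= M * g n]).

End Defs.

Arguments CkE {R} k E _.

(* Main.v *)
Require Import Defs.
From mathcomp Require Import all_boot all_order all_algebra finmap.
From mathcomp Require Import all_classical all_reals all_analysis.
From mathcomp Require Import ring lra.

Import Order.TTheory GRing.Theory Num.Theory.
Import numFieldNormedType.Exports.

Local Open Scope classical_set_scope.
Local Open Scope ring_scope.

(* Moebius inversion over the gcd gives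
     |Q(k, n)| = \sum_(d <= D) mobius d * \prod_i floor(n_i / d)
   for every D bounding all n_i. On C^k_E each n_i is at most E * gamma, so with
   D = floor(E * gamma) dropping the floors costs
   O(\sum_(d <= D) (gamma / d)^(k-1)). The remaining main term is
   gamma^k * \sum_(d <= D) mobius d / d^k; comparing the finite identity
   \sum_(d <= D) mobius d / d^k * \sum_(e <= D / d) 1 / e^k = 1 with zeta(k)
   shows that it differs from gamma^k / zeta(k) by O(gamma * ln gamma), so no
   infinite Dirichlet product is needed. *)

(** * The Moebius function and its divisor sums *)

(** For positive [n] this is the classical function: a prime of exponent at least 2 contributes a
    factor 0. *)
Definition mobius (n : nat) : int :=
  \prod_(p <- primes n) (if logn p n == 1%N then -1 else 0).

Lemma norm_mobius_le1 n : `|mobius n| <= 1.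
Proof.
rewrite /mobius; elim/big_ind: _ => // [x y x1 y1|p _].
  by rewrite normrM mulr_ile1.
by case: ifP => _; rewrite ?normrN ?normr1 ?normr0.
Qed.

Lemma mobiusM_prime p n : prime p -> (0 < n)%N -> ~~ (p %| n)%N ->
  mobius (p * n) = - mobius n.
Proof.
move=> pp n0 pn; have p0 := prime_gt0 pp.
have pnP : p \notin primes n by rewrite mem_primes pp n0.
have perm : perm_eq (primes (p * n)) (p :: primes n).
  apply: uniq_perm; rewrite /= ?pnP ?primes_uniq// => q.
  by rewrite primesM// primes_prime// !inE.
rewrite /mobius (perm_big _ perm)/= big_cons.
rewrite lognM// (logn_prime _ pp) eqxx (lognE p n) pp n0 (negbTE pn)/= mulN1r.
congr (- _); rewrite big_seq_cond [RHS]big_seq_cond.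
apply: eq_bigr => q /andP[qn _]; rewrite lognM// (logn_prime _ pp).
by have /negbTE-> : q != p by apply: contraNneq pnP => <-.
Qed.

Lemma mobius_eq0 p n : prime p -> (1 < logn p n)%N -> mobius n = 0.
Proof.
move=> pp pn; have pnP : p \in primes n by rewrite -logn_gt0 ltnW.
rewrite /mobius (big_rem p)//=.
by case: eqP pn => [->//|_ _]; rewrite mul0r.
Qed.

(* Fix a prime p dividing n. Only the divisors d with logn p d <= 1 count,
   and d |-> p * d exchanges those with logn p d = 0 and logn p d = 1 while
   changing the sign of mobius d. *)
Lemma sum_mobius_divisors n : (0 < n)%N ->
  \sum_(d <- divisors n) mobius d = (n == 1%N)%:R.
Proof.
move=> n0; have [->|n1] := eqVneq n 1%N.
  by rewrite big_seq1 /mobius big_nil.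
have n_gt1 : (1 < n)%N by case: n n0 n1 => [|[]].
pose p := pdiv n; have pp : prime p := pdiv_prime n_gt1.
have p0 := prime_gt0 pp.
rewrite (bigID (fun d => ~~ (p %| d)%N))/=; apply/eqP; rewrite addrC addr_eq0.
rewrite (bigID (fun d => logn p d == 1%N))/= [X in _ + X]big_seq_cond.
rewrite [X in _ + X]big1 ?addr0; last first.
  move=> d /andP[]; rewrite -dvdn_divisors// => dn; rewrite negbK => /andP[pd d1].
  apply: (mobius_eq0 _ _ pp); rewrite ltn_neqAle eq_sym d1 logn_gt0.
  by rewrite mem_primes pp pd (dvdn_gt0 n0 dn).
rewrite -sumrN -big_filter -[X in _ == X]big_filter.
rewrite (perm_big [seq (p * d)%N | d <- [seq d <- divisors n | ~~ (p %| d)%N]]).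
  rewrite big_map big_seq [X in _ == X]big_seq; apply/eqP/eq_bigr => d.
  rewrite mem_filter -dvdn_divisors// => /andP[pd dn].
  by rewrite mobiusM_prime// (dvdn_gt0 n0 dn).
apply: uniq_perm.
- by rewrite filter_uniq ?divisors_uniq.
- rewrite map_inj_uniq ?filter_uniq ?divisors_uniq// => a b /eqP.
  by rewrite eqn_pmul2l// => /eqP.
move=> d; rewrite mem_filter -dvdn_divisors// negbK.
apply/idP/mapP => [/andP[/andP[pd /eqP d1] dn]|[e]].
  have d0 := dvdn_gt0 n0 dn.
  exists (d %/ p)%N; last by rewrite mulnC divnK.
  rewrite mem_filter -dvdn_divisors// (dvdn_trans (dvdn_div pd) dn) andbT.
  apply/negP => pdp; have dp0 : (0 < d %/ p)%N by rewrite divn_gt0// dvdn_leq.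
  move: d1; rewrite -(divnK pd) lognM// (logn_prime _ pp) eqxx addn1 => -[] /eqP.
  by rewrite -leqn0 leqNgt logn_gt0 mem_primes pp dp0 pdp.
rewrite mem_filter -dvdn_divisors// => /andP[pe en] ->.
have e0 := dvdn_gt0 n0 en.
rewrite dvdn_mulr// lognM// (logn_prime _ pp) eqxx (lognE p e) pp e0 (negbTE pe)/=.
by rewrite Gauss_dvd ?prime_coprime// pdiv_dvd.
Qed.

(** A range for [d] that does not depend on [n] allows the sums over [d] and over [n] to be
    exchanged later. *)
Lemma sum_mobius_dvd n D : (0 < n <= D)%N ->
  \sum_(1 <= d < D.+1 | (d %| n)%N) mobius d = (n == 1%N)%:R.
Proof.
move=> /andP[n0 nD]; rewrite -sum_mobius_divisors// -big_filter.
apply: perm_big; apply: uniq_perm.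
- by rewrite filter_uniq ?iota_uniq.
- exact: divisors_uniq.
move=> d; rewrite mem_filter mem_index_iota -dvdn_divisors//.
case dn: (d %| n)%N => //=.
by rewrite (dvdn_gt0 n0 dn) ltnS (leq_trans (dvdn_leq n0 dn) nD).
Qed.

Lemma sum_multiples (V : nmodType) (F : nat -> V) d n : (0 < d)%N ->
  \sum_(1 <= j < n.+1 | (d %| j)%N) F j =
  \sum_(1 <= e < (n %/ d).+1) F (d * e)%N.
Proof.
move=> d0; elim: n => [|n IHn]; first by rewrite div0n !big_geq.
rewrite big_mkcond big_nat_recr//= -big_mkcond/= {}IHn divnS//.
case: ifP => dn; rewrite ?addr0//= add1n [RHS]big_nat_recr//=; congr (_ + F _).
rewrite -[LHS](divnK dn) [LHS]mulnC; congr (_ * _)%N.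
by rewrite divnS// dn.
Qed.

(** The index type depends on neither [m] nor [d], so a product of such counts expands over a single
    type of functions. *)
Lemma count_multiples d m N : (0 < d)%N -> (m <= N)%N ->
  (\sum_(j < N.+1) [&& 0 < j, j <= m & d %| j] = m %/ d)%N.
Proof.
move=> d0 mN; rewrite divn_count_dvd (big_nat_widen _ _ N.+1)//.
rewrite (big_nat_widenl _ 0)// big_mkord [RHS]big_mkcond.
by apply: eq_bigr => j _; rewrite ltnS; case: (0 < j)%N (j <= m)%N => [] [].
Qed.

(** * Counting coprime tuples by inversion over the gcd *)

Section Counting.
Context {R : realType}.

Lemma cardQE (k N : nat) (n : 'rV[R]_k) :
  (forall i, 0 <= n ord0 i) -> (forall i, Num.truncn (n ord0 i) <= N)%N ->
  cardQ n = #|[pred g : {ffun 'I_k -> 'I_N.+1} |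
     [forall i, 0 < g i <= Num.truncn (n ord0 i)]%N &&
     (\big[gcdn/0%N]_(i < k) g i == 1%N)]|.
Proof.
move=> n0 nN; set P := [pred g | _].
pose h (g : {ffun 'I_k -> 'I_N.+1}) : {ffun 'I_k -> nat} :=
  [ffun i => nat_of_ord (g i)].
have h_inj : injective h.
  by move=> f g /ffunP fg; apply/ffunP => i; apply/val_inj;
    have := fg i; rewrite !ffunE.
rewrite /cardQ; suff -> : fset_set (Q n) = [fset h g | g in P]%fset
  by rewrite card_imfset// cardE.
apply/fsetP => a; rewrite in_fset_set ?mem_setE; last exact: finite_Q.
apply/idP/imfsetP => /=.
  rewrite inE => -[a0 ag an].
  have aN i : (a i < N.+1)%N.
    by rewrite ltnS; apply: leq_trans (nN i); rewrite truncn_ge_nat.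
  have ha i : ([ffun i => inord (a i)] : {ffun 'I_k -> 'I_N.+1}) i = a i :> nat.
    by rewrite ffunE inordK.
  exists [ffun i => inord (a i)]; last by apply/ffunP => i; rewrite ffunE ha.
  rewrite inE; apply/andP; split.
    by apply/forallP => i; rewrite ha a0 truncn_ge_nat ?an.
  by rewrite -ag; apply/eqP/eq_bigr => i _; rewrite ha.
move=> [g]; rewrite inE => /andP[/forallP gn /eqP gg] ->; split.
- by move=> i; rewrite ffunE; case/andP: (gn i).
- by rewrite -gg; apply: eq_bigr => i _; rewrite ffunE.
- by move=> i; rewrite ffunE -truncn_ge_nat//; case/andP: (gn i).
Qed.

Lemma prod_nat_of_bool (I : finType) (b : pred I) :
  (\prod_i b i)%N = [forall i, b i].
Proof.
case: (boolP [forall i, b i]) => [/forallP bT|/forallPn[i /negbTE bi]].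
  by rewrite big1// => i _; rewrite bT.
by rewrite (bigD1 i)//= bi mul0n.
Qed.

(** The indicator of gcd 1 is the sum of [mobius d] over the [d] dividing the gcd. After exchanging
    the sums, the tuples with all entries divisible by [d] are counted coordinate by coordinate. *)
Lemma cardQ_mobius (k N : nat) (n : 'rV[R]_k) : (0 < k)%N ->
  (forall i, 0 <= n ord0 i) -> (forall i, Num.truncn (n ord0 i) <= N)%N ->
  (cardQ n)%:Z = \sum_(1 <= d < N.+1)
    mobius d * (\prod_(i < k) (Num.truncn (n ord0 i) %/ d))%N%:Z.
Proof.
case: k n => // k n _ n0 nN; rewrite (cardQE _ _ _ n0 nN) -sum1_card.
set m := fun i => Num.truncn (n ord0 i).
pose G (g : {ffun 'I_k.+1 -> 'I_N.+1}) := (\big[gcdn/0]_(i < k.+1) g i)%N.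
rewrite (eq_big_nat _ _ (F2 := fun d => \sum_(g : {ffun 'I_k.+1 -> 'I_N.+1} |
    [forall i, 0 < g i <= m i]%N && (d %| G g)%N) mobius d)); last first.
  move=> d /andP[d0 _].
  rewrite (eq_bigr (fun i => \sum_(j < N.+1) [&& 0 < j, j <= m i & d %| j])%N);
    last by move=> i _; rewrite count_multiples// nN.
  rewrite bigA_distr_bigA/= -natz natr_sum mulr_sumr [RHS]big_mkcond/=.
  apply: eq_bigr => g _; rewrite prod_nat_of_bool.
  have -> : [forall i, [&& 0 < g i, g i <= m i & d %| g i]]%N =
      [forall i, 0 < g i <= m i]%N && (d %| G g)%N.
    apply/forallP/andP => [gP|[/forallP gm /dvdn_biggcdP gd] i].
      split; first by apply/forallP => i; have /and3P[-> ->] := gP i.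
      by apply/dvdn_biggcdP => i _; have /and3P[] := gP i.
    by rewrite andbA gm gd.
  by case: ifP => _; rewrite ?mulr1 ?mulr0.
rewrite -natz natr_sum (exchange_big_dep (fun g : {ffun 'I_k.+1 -> 'I_N.+1} =>
  [forall i, 0 < g i <= m i]%N))/=;
  last by move=> d g _ /andP[].
rewrite big_mkcondr/=; apply: eq_bigr => g /[dup] gm ->/=.
rewrite sum_mobius_dvd -?/(G g); first by case: eqP.
(* The gcd divides the first entry, which lies between 1 and [N]; hence so does the gcd. *)
have /forallP gm' := gm; have /andP[g0 _] := gm' ord0.
have Gg : (G g %| g ord0)%N by apply: (elimT (dvdn_biggcdP _ _ _) (dvdnn _)).
by rewrite (dvdn_gt0 g0 Gg) (leq_trans (dvdn_leq g0 Gg))// -ltnS.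
Qed.
End Counting.

(** * Partial sums and tails of the zeta series *)

Section Zeta.
Context {R : realType}.

(** The induction step is [ln (1 + x) <= x] at [x = - n.+2%:R^-1]. *)
Lemma harmonic_le_ln (n : nat) : (0 < n)%N ->
  \sum_(1 <= d < n.+1) d%:R^-1 <= 1 + ln (n%:R : R).
Proof.
elim: n => // -[_ _|n IHn _]; first by rewrite big_nat1 invr1 ln1 addr0.
rewrite big_nat_recr//=; apply: (le_trans (lerD (IHn isT) (lexx _))).
rewrite -addrA lerD2l -lerBrDl -[leRHS]opprB lerNr -ln_div ?posrE ?ltr0n//.
have -> : n.+1%:R / n.+2%:R = 1 + - n.+2%:R^-1 :> R.
  rewrite -[n.+2%:R]natr1; set x : R := n.+1%:R; have x0 : 0 < x by rewrite ltr0n.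
  by field; lra.
by apply: le_ln1Dx; rewrite ltrN2 invf_lt1 ?ltr0n// ltr1n.
Qed.

Lemma sum_invX_tail (p J L : nat) : (0 < J <= L)%N ->
  \sum_(J.+1 <= e < L.+1) (e%:R ^+ p.+2)^-1 <= (J%:R ^+ p.+1)^-1 :> R.
Proof.
move=> /andP[J0 JL].
(* The sharper bound telescopes: the term at [l + 1] is at most [J^-p * (1 / l - 1 / (l + 1))]. *)
suff : \sum_(J.+1 <= e < L.+1) (e%:R ^+ p.+2)^-1 <=
    (J%:R ^+ p)^-1 * (J%:R^-1 - L%:R^-1) :> R.
  move=> /le_trans; apply; rewrite exprS invfM mulrC ler_wpM2r//.
  by rewrite gerBl invr_ge0.
rewrite -(subnK JL); elim: (L - J)%N => [|i IHi].
  by rewrite add0n big_geq// subrr mulr0.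
rewrite addSn big_nat_recr/= ?ltnS ?leq_addl//.
apply: le_trans (lerD IHi (lexx _)) _.
set l := (i + J)%N; have l0 : (0 < l)%N by rewrite addn_gt0 J0 orbT.
rewrite -lerBrDl -mulrBr.
have -> : J%:R^-1 - l.+1%:R^-1 - (J%:R^-1 - l%:R^-1) = l%:R^-1 - l.+1%:R^-1 :> R.
  by ring.
rewrite -addn2 exprD invfM; apply: ler_pM; rewrite ?invr_ge0 ?exprn_ge0//.
  by rewrite lef_pV2 ?posrE ?exprn_gt0 ?ltr0n// lerXn2r ?nnegrE//
    ler_nat /l -addSn leq_addl.
have -> : l%:R^-1 - l.+1%:R^-1 = (l%:R * l.+1%:R)^-1 :> R.
  rewrite -natr1; have x0 : 0 < l%:R :> R by rewrite ltr0n.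
  by move: x0; set x := l%:R => x0; field; lra.
by rewrite expr2 lef_pV2 ?posrE ?mulr_gt0 ?ltr0n// ler_wpM2r// ler_nat.
Qed.

Lemma series_riemannRE (k n : nat) :
  series (riemannR (k%:R : R)) n = \sum_(1 <= e < n.+1) (e%:R ^+ k)^-1.
Proof.
rewrite seriesEnat/= [RHS]big_add1/=; apply: eq_bigr => i _.
by rewrite /riemannR powR_mulrn.
Qed.

Lemma zeta_bounds (p J : nat) : (0 < J)%N ->
  \sum_(1 <= e < J.+1) (e%:R ^+ p.+2)^-1 <= zeta (p.+2%:R : R) <=
  \sum_(1 <= e < J.+1) (e%:R ^+ p.+2)^-1 + (J%:R ^+ p.+1)^-1.
Proof.
move=> J0; set S := fun n => \sum_(1 <= e < n.+1) (e%:R ^+ p.+2)^-1 : R.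
have SE : series (riemannR (p.+2%:R : R)) = S.
  by apply/funext => n; exact: series_riemannRE.
have S_nd : {homo S : n m / (n <= m)%N >-> n <= m}.
  move=> n m nm; rewrite /S [leRHS](big_cat_nat (n := n.+1))//= lerDl.
  by apply: sumr_ge0 => i _; rewrite invr_ge0 exprn_ge0.
have S_ub n : S n <= S J + (J%:R ^+ p.+1)^-1.
  have [nJ|Jn] := leqP n J.
    by rewrite (le_trans (S_nd _ _ nJ))// lerDl invr_ge0 exprn_ge0.
  rewrite /S [leLHS](big_cat_nat (n := J.+1))/= ?ltnS 1?ltnW// lerD2l.
  by rewrite sum_invX_tail// J0 ltnW.
(* [limn] is a meaningful value only for a convergent sequence; here the partial sums are monotone
   and bounded. *)
have S_cvg : cvgn S.
  apply: nondecreasing_is_cvgn => //.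
  by exists (S J + (J%:R ^+ p.+1)^-1) => _ [n _ <-].
rewrite /zeta SE; apply/andP; split; first exact: nondecreasing_cvgn_le.
by apply: limr_le => //; apply: nearW.
Qed.

(* The tails of zeta at D / d are compared with the finite identity
   \sum_(d <= D) mobius d * d^-k * \sum_(e <= D / d) e^-k = 1. *)
Lemma sum_mobius_zeta (p D : nat) : (0 < D)%N ->
  `|(\sum_(1 <= d < D.+1) (mobius d)%:~R * (d%:R ^+ p.+2)^-1) *
      zeta (p.+2%:R : R) - 1| <=
  (2 / D%:R) ^+ p.+1 * (1 + ln D%:R).
Proof.
move=> D0; pose S n : R := \sum_(1 <= e < n.+1) (e%:R ^+ p.+2)^-1.
have id1 : \sum_(1 <= d < D.+1) (mobius d)%:~R * (d%:R ^+ p.+2)^-1 * S (D %/ d)%N = 1.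
  (* Put [j = d * e]. After the exchange, [j^-k] has as coefficient the sum of [mobius d] over [d]
     dividing [j], so only [j = 1] survives. *)
  transitivity (\sum_(1 <= d < D.+1) \sum_(1 <= j < D.+1 | (d %| j)%N)
      (mobius d)%:~R * (j%:R ^+ p.+2)^-1 : R).
    apply: eq_big_nat => d /andP[d0 _]; rewrite sum_multiples// mulr_sumr.
    by apply: eq_bigr => e _; rewrite natrM exprMn -mulrA -(invfM (_ ^+ _)).
  rewrite (exchange_big_dep xpredT)//=.
  rewrite big_ltn// [X in _ + X]big1_seq ?addr0; last first.
    move=> j; rewrite andTb mem_index_iota => /andP[j1 jD].
    rewrite -mulr_suml -rmorph_sum/= sum_mobius_dvd ?(ltnW j1)//.
    by rewrite gtn_eqF// mul0r.
  by rewrite -mulr_suml -rmorph_sum/= sum_mobius_dvd// expr1n invr1 mulr1.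
rewrite -[X in _ - X]id1 mulr_suml -sumrB.
apply: (le_trans (ler_norm_sum _ _ _)).
apply: (@le_trans _ _ ((2 / D%:R) ^+ p.+1 * \sum_(1 <= d < D.+1) d%:R^-1)); last first.
  by rewrite ler_wpM2l ?exprn_ge0 ?divr_ge0// harmonic_le_ln.
rewrite mulr_sumr; apply: ler_sum_nat => d /andP[d0 dD].
have d0R : 0 < d%:R :> R by rewrite ltr0n.
have Dd0 : (0 < D %/ d)%N by rewrite divn_gt0.
have /andP[zl zu] := zeta_bounds p _ Dd0; rewrite -/(S _) in zl zu.
have mu1 : `|(mobius d)%:~R : R| <= 1.
  by rewrite -intr_norm lerz1 norm_mobius_le1.
(* As [d <= D], the quotient is at least 1, so rounding down loses at most a factor 2; this is the 2
   in the bound. *)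
have DdE : 0 < (D%:R : R) / d%:R / 2 <= (D %/ d)%:R.
  rewrite !divr_gt0 ?ltr0n//= ler_pdivrMr// ler_pdivrMr// -!natrM ler_nat.
  rewrite -mulnA [(2 * d)%N]mulnC mulnA {1}(divn_eq D d).
  rewrite muln2 -addnn leq_add2l ltnW// (leq_trans (ltn_pmod _ d0))//.
  by rewrite leq_pmull.
have tail : `|zeta p.+2%:R - S (D %/ d)%N| <= (2 / D%:R) ^+ p.+1 * d%:R ^+ p.+1.
  rewrite ger0_norm ?subr_ge0// -exprMn lerBlDl (le_trans zu)// lerD2l -exprVn.
  case/andP: DdE => x0 xle; rewrite lerXn2r ?nnegrE ?invr_ge0 ?mulr_ge0 ?invr_ge0//.
  rewrite -[leRHS]invrK lef_pV2 ?posrE ?invr_gt0 ?mulr_gt0 ?invr_gt0 ?ltr0n//.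
  by rewrite (le_trans _ xle)// !invfM invrK [_ * D%:R]mulrC mulrAC.
rewrite -mulrBr !normrM normfV (ger0_norm (exprn_ge0 _ (ltW d0R))).
(* The powers of [d] cancel down to [1 / d], which leaves a harmonic sum. *)
apply: (@le_trans _ _ ((d%:R ^+ p.+2)^-1 * ((2 / D%:R) ^+ p.+1 * d%:R ^+ p.+1))).
  apply: ler_pM => //.
  by rewrite ler_piMl// invr_ge0 exprn_ge0.
rewrite mulrCA ler_wpM2l ?exprn_ge0 ?divr_ge0//.
by rewrite [d%:R ^+ p.+2]exprS invfM -mulrA mulVf ?mulr1// expf_neq0 ?gt_eqF.
Qed.
End Zeta.

(** * An explicit error bound *)

Section Estimate.
Context {R : realType}.

(** The factors are replaced one at a time; each of the [k] replacements costs at most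
    [X ^+ k.-1]. *)
Lemma prod_sub_le (k : nat) (x y : 'I_k -> R) (X : R) :
  (forall i, 0 <= y i <= x i) -> (forall i, x i <= X) ->
  (forall i, x i - y i <= 1) ->
  0 <= \prod_(i < k) x i - \prod_(i < k) y i <= k%:R * X ^+ k.-1.
Proof.
move=> yx xX xy1; rewrite subr_ge0 ler_prod//=.
elim: k x y yx xX xy1 => [|k IHk] x y yx xX xy1.
  by rewrite !big_ord0 subrr mul0r.
have x0 i : 0 <= x i by have /andP[/le_trans h /h] := yx i.
have X0 : 0 <= X := le_trans (x0 ord0) (xX ord0).
have y0 i : 0 <= y i by have /andP[] := yx i.
rewrite !big_ord_recl; set xs := \prod_(i < k) _; set ys := \prod_(i < k) _.
have -> : x ord0 * xs - y ord0 * ys = x ord0 * (xs - ys) + (x ord0 - y ord0) * ys.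
  by ring.
have ysX : ys <= X ^+ k.
  have -> : X ^+ k = \prod_(i < k) X by rewrite prodr_const card_ord.
  apply: ler_prod => i _.
  by rewrite y0 (le_trans _ (xX (lift ord0 i)))//; have /andP[] := yx (lift ord0 i).
have ys0 : 0 <= ys by apply: prodr_ge0.
rewrite -natr1 [leRHS]mulrDl mul1r/= lerD//; last first.
  by rewrite (le_trans (ler_piMl _ _) ysX)// xy1.
have xsE : k%:R * X ^+ k = X * (k%:R * X ^+ k.-1).
  by case: (k) => [|k']; rewrite ?mul0r ?mulr0//= exprS mulrCA.
rewrite xsE; apply: ler_pM => //.
  by rewrite subr_ge0 ler_prod// => i _.
by apply: IHk => i.
Qed.

(** Here [g] stands for the geometric mean. The first error term comes from dropping the floors, the
    second from replacing the truncated Moebius sum by [1 / zeta]. *)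
Lemma cardQ_estimate (p : nat) (n : 'rV[R]_p.+2) (E g : R) :
  1 <= E -> 1 <= g -> (forall i, 1 <= n ord0 i <= E * g) ->
  \prod_(i < p.+2) n ord0 i = g ^+ p.+2 ->
  `|(cardQ n)%:R - (\prod_(i < p.+2) n ord0 i) / zeta p.+2%:R| <=
  p.+2%:R * (E * g) ^+ p.+1 *
    (\sum_(1 <= d < (Num.truncn (E * g)).+1) (d%:R ^+ p.+1)^-1) +
  4 ^+ p.+1 * g * (1 + ln (E * g)).
Proof.
move=> E1 g1 nE nP; set D := Num.truncn (E * g); set P := \prod_(i < _) _.
have g0 : 0 < g by apply: lt_le_trans g1.
have Eg1 : 1 <= E * g by rewrite mulr_ege1.
have Eg0 : 0 <= E * g by apply: le_trans Eg1.
have n0 i : 0 <= n ord0 i by have /andP[/(le_trans ler01)] := nE i.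
have D0 : (0 < D)%N by rewrite truncn_ge_nat.
have /andP[Dl Du] := truncn_itv Eg0; rewrite -/D in Dl Du.
have D0R : 0 < D%:R :> R by rewrite ltr0n.
have nD i : (Num.truncn (n ord0 i) <= D)%N.
  rewrite truncn_ge_nat// (@le_trans _ _ (n ord0 i)) ?truncn_le//.
  by have /andP[] := nE i.
have cardE : (cardQ n)%:R = \sum_(1 <= d < D.+1) (mobius d)%:~R *
    \prod_(i < p.+2) (Num.truncn (n ord0 i) %/ d)%N%:R :> R.
  rewrite pmulrn (cardQ_mobius _ D)// rmorph_sum/=; apply: eq_bigr => d _.
  by rewrite rmorphM/= -pmulrn natr_prod.
pose B : R := \sum_(1 <= d < D.+1) (mobius d)%:~R * (d%:R ^+ p.+2)^-1.
pose z : R := zeta p.+2%:R.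
have z1 : 1 <= z.
  have /andP[+ _] := zeta_bounds p 1 isT (R := R).
  by rewrite big_nat1 expr1n invr1.
have -> : (cardQ n)%:R - P / z = ((cardQ n)%:R - B * P) + P * (B * z - 1) / z.
  by field; lra.
rewrite (le_trans (ler_normD _ _))// lerD//.
  rewrite cardE /B mulr_suml -sumrB (le_trans (ler_norm_sum _ _ _))// mulr_sumr.
  apply: ler_sum_nat => d /andP[d0 dD]; have d0R : 0 < d%:R :> R by rewrite ltr0n.
  rewrite -[_ * P]mulrA -mulrBr normrM -[leRHS]mulrA.
  have -> : (d%:R ^+ p.+2)^-1 * P = \prod_(i < p.+2) (n ord0 i / d%:R).
    by rewrite big_split/= prodr_const card_ord exprVn mulrC.
  rewrite (le_trans (ler_piMl _ _))//.
    by rewrite -intr_norm lerz1 norm_mobius_le1.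
  rewrite distrC -expr_div_n.
  (* Taking the floor of [n_i] before dividing by [d] still loses at most 1 in total. *)
  pose x i := n ord0 i / d%:R; pose y i : R := (Num.truncn (n ord0 i) %/ d)%N%:R.
  have yx i : 0 <= y i <= x i.
    rewrite ler0n /x ler_pdivlMr// -natrM.
    by rewrite (@le_trans _ _ (Num.truncn (n ord0 i))%:R) ?truncn_le// ler_nat leq_divM.
  have xE i : x i <= E * g / d%:R.
    by rewrite ler_wpM2r ?invr_ge0//; have /andP[] := nE i.
  have xy1 i : x i - y i <= 1.
    rewrite lerBlDl natr1 ler_pdivrMr// -natrM ltW//.
    have /andP[_ /lt_le_trans->//] := truncn_itv (n0 i).
    by rewrite ler_nat ltn_ceil.
  by have /andP[/ger0_norm->] := prod_sub_le _ _ _ _ yx xE xy1.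
rewrite !normrM normfV (ger0_norm (le_trans ler01 z1)).
rewrite (le_trans (ler_piMr _ _))// ?mulr_ge0// ?invf_le1 ?(lt_le_trans ltr01)//.
rewrite /P nP ger0_norm ?exprn_ge0 ?(ltW g0)//.
have S := sum_mobius_zeta p D D0 (R := R); rewrite -/B -/z in S.
rewrite (le_trans (ler_wpM2l _ S)) ?exprn_ge0 ?(ltW g0)//.
have -> : 4 ^+ p.+1 * g = g ^+ p.+2 * (4 / g) ^+ p.+1.
  rewrite expr_div_n [g ^+ p.+2]exprS -mulrA [_ * (_ / _)]mulrC divfK
    ?expf_neq0 ?gt_eqF//.
  by rewrite mulrC.
rewrite -mulrA ler_wpM2l ?exprn_ge0 ?(ltW g0)//.
apply: ler_pM; rewrite ?exprn_ge0 ?divr_ge0//.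
- by rewrite addr_ge0// ln_ge0// ler1n.
(* From [g <= E * g < D + 1 <= 2 * D] follows [2 / D <= 4 / g]. *)
- rewrite lerXn2r ?nnegrE ?divr_ge0 ?(ltW g0)// ler_pdivrMr// mulrAC ler_pdivlMr//.
  have D1 : 1 <= D%:R :> R by rewrite ler1n.
  by move: Du; rewrite -natr1 => Du; nra.
- by rewrite lerD2l ler_ln// posrE (lt_le_trans ltr01).
Qed.
End Estimate.

(** * The region: compactness and the geometric mean *)

Section Region.
Context {R : realType}.

(** Pairwise inequalities without quotients or extrema are visibly closed conditions and can be
    multiplied over the coordinates. *)
Lemma CkEE (k : nat) (E : R) : (0 < k)%N -> 0 < E ->
  CkE k E = [set n : 'rV[R]_k | forall i, 1 <= n ord0 i] `&`
            [set n : 'rV[R]_k | forall i j, n ord0 i <= E * n ord0 j].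
Proof.
case: k => // k _ E0; apply/seteqP; split=> n /= [n1].
all: have nmax i : n ord0 i <= vmax n by exact: le_bigmax.
all: have vmin0 : 0 < vmin n
  by rewrite (lt_le_trans ltr01)// le_bigmin ?(le_trans (n1 ord0)).
  rewrite ler_pdivrMr// => nE; split=> // i j.
  by rewrite (le_trans (nmax i))// (le_trans nE)// ler_wpM2l ?(ltW E0)// bigmin_le.
move=> nE; split=> //; rewrite ler_pdivrMr//.
apply: bigmax_le => [|i _]; first by rewrite ltW// mulr_gt0.
rewrite -ler_pdivrMl// le_bigmin// => [|j _]; rewrite ler_pdivrMl//.
by rewrite (le_trans (nE i i))// ler_wpM2l// ltW.
Qed.

(** The set is a closed part of the box with all coordinates in [[1, B]]. *)
Lemma compact_CkE_le (k : nat) (E B : R) : (0 < k)%N -> 0 < E ->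
  compact (CkE k E `&` [set n : 'rV[R]_k | forall i, n ord0 i <= B]).
Proof.
move=> k0 E0; rewrite CkEE//.
pose box : set 'rV[R]_k := [set n | forall i, `[1, B]%classic (n ord0 i)].
pose ratio (ij : 'I_k * 'I_k) : set 'rV[R]_k :=
  (fun n : 'rV[R]_k => n ord0 ij.1 - E * n ord0 ij.2) @^-1` [set x | x <= 0].
have -> : [set n : 'rV[R]_k | forall i, 1 <= n ord0 i] `&`
    [set n : 'rV[R]_k | forall i j, n ord0 i <= E * n ord0 j] `&`
    [set n : 'rV[R]_k | forall i, n ord0 i <= B] =
    box `&` \bigcap_(ij in setT) ratio ij.
  apply/seteqP; split=> n /= => [[[n1 nE] nB]|[nbox nE]].
    split=> [i|[i j] _]; first by rewrite /= in_itv/= n1 nB.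
    by rewrite /ratio/= subr_le0.
  split; [split=> [i|i j]|move=> i].
  - by have := nbox i; rewrite /= in_itv/= => /andP[].
  - by have := nE (i, j) I; rewrite /ratio/= subr_le0.
  - by have := nbox i; rewrite /= in_itv/= => /andP[].
apply: compact_closedI;
  first by apply: (@rV_compact R k (fun=> `[1, B]%classic)) => i;
    exact: segment_compact.
apply: closed_bigI => -[i j] _.
suff /continuous_closedP/(_ _ (closed_le (y := 0))) :
  continuous (fun n : 'rV[R]_k => n ord0 i - E * n ord0 j) by [].
have coordC l : continuous (fun n : 'rV[R]_k => n ord0 l) by exact: coord_continuous.
move=> n; have Ec := continuousM (@cst_continuous _ _ E n) (coordC j n).
exact: (continuousB (coordC i n) Ec).
Qed.

Lemma gmeanX (k : nat) (n : 'rV[R]_k) : (0 < k)%N ->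
  (forall i, 0 <= n ord0 i) -> gmean n ^+ k = \prod_(i < k) n ord0 i.
Proof.
move=> k0 n0; rewrite -powR_mulrn ?powR_ge0// -powRrM mulVf ?pnatr_eq0 -?lt0n//.
by rewrite powRr1// prodr_ge0.
Qed.

(** Multiply [n_i <= E * n_j] over all [j] and compare [k]-th powers. *)
Lemma CkE_le_gmean (k : nat) (E : R) (n : 'rV[R]_k) (i : 'I_k) :
  0 < E -> CkE k E n -> n ord0 i <= E * gmean n.
Proof.
move=> E0; have k0 : (0 < k)%N by case: (k) i => [[]|].
rewrite CkEE// => -[n1 nE]; have n0 j : 0 <= n ord0 j := le_trans ler01 (n1 j).
rewrite -(ler_pXn2r k0) ?nnegrE ?mulr_ge0 ?powR_ge0 ?(ltW E0)//.
rewrite exprMn gmeanX//.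
have -> : E ^+ k = \prod_(j < k) E by rewrite prodr_const card_ord.
have -> : n ord0 i ^+ k = \prod_(j < k) n ord0 i by rewrite prodr_const card_ord.
by rewrite -big_split/=; apply: ler_prod => j _; rewrite n0 nE.
Qed.

End Region.

(** * Choice of the compact set and of the constant *)

Theorem theorem5p2 (R : realType) (k : nat) (E : R)
    (hk : (2 <= k)%N) (hE : 1 <= E) :
  bigO_on (CkE k E)
    (fun n : 'rV[R]_k => (cardQ n)%:R)
    (fun n : 'rV[R]_k => (\prod_(i < k) n ord0 i) / zeta k%:R)
    (fun n : 'rV[R]_k => fk n).
Proof.
have k0 : (0 < k)%N by exact: leq_trans hk.
have E0 : 0 < E by exact: lt_le_trans hE.
(* The cut-off [E * expR 1] forces [ln (gmean n) >= 1] outside [C]: then [fk] is positive, and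
   constants are absorbed into the logarithm. *)
pose C := CkE k E `&` [set n : 'rV[R]_k | forall i, n ord0 i <= E * expR 1].
have C_compact : compact C by exact: compact_CkE_le.
have CE : C `<=` CkE k E by move=> n [].
have out n : (CkE k E `\` C) n -> expR 1 <= gmean n.
  move=> [nE nC]; rewrite leNgt; apply/negP => g_lt; apply: nC; split=> // i.
  by rewrite (le_trans (CkE_le_gmean _ _ _ i E0 nE))// ler_wpM2l// ltW.
have g_gt0 n : (CkE k E `\` C) n -> 0 < gmean n.
  by move=> /out; apply: lt_le_trans; exact: expR_gt0.
have lng n : (CkE k E `\` C) n -> 1 <= ln (gmean n).
  by move=> nC; rewrite -[leLHS]expRK ler_ln ?posrE ?expR_gt0 ?g_gt0// out.
split.
  exists C; split=> // n nC; rewrite /fk; case: ifP => _.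
    by rewrite mulr_gt0 ?g_gt0// (lt_le_trans ltr01) ?lng.
  by rewrite exprn_gt0 ?g_gt0.
(* Chosen so that [1 + ln (E * g) <= A * ln g] as soon as [ln g >= 1]. *)
pose A := 2 + ln E.
have lnE : 0 <= ln E by rewrite ln_ge0.
(* In [A + 2], the [A] serves the harmonic sum for [k = 2], and the 2 bounds the sum of [d^-(k-1)]
   for [k > 2]. *)
exists (k%:R * E ^+ k.-1 * (A + 2) + 4 ^+ k.-1 * A), C; split=> // n nC.
have nE : CkE k E n by case: nC.
have := out n nC; have := g_gt0 n nC; have := lng n nC.
have : forall i, 1 <= n ord0 i <= E * gmean n.
  by move=> i; rewrite CkE_le_gmean// andbT; case: nE.
have : \prod_(i < k) n ord0 i = gmean n ^+ k.
  by rewrite gmeanX// => i; case: nE => n1 _; rewrite (le_trans ler01).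
rewrite /fk; set g := gmean n; clearbody g.
clear nC nE out g_gt0 lng C C_compact CE k0.
case: k hk n => // -[//|p] _ n nP nEg lng g0 ge.
have g1 : 1 <= g by rewrite (le_trans _ ge)// (le_trans _ (expR_ge1Dx 1))// lerDl.
have lnEg : 1 + ln (E * g) <= A * ln g.
  by rewrite lnM ?posrE// /A; nra.
apply: (le_trans (cardQ_estimate _ _ _ _ hE g1 nEg nP)).
have Eg1 : 1 <= E * g by rewrite mulr_ege1.
have Eg0 : 0 < E * g by exact: lt_le_trans Eg1.
set D := Num.truncn (E * g).
have D0 : (0 < D)%N by rewrite truncn_ge_nat// ltW.
have DEg : D%:R <= E * g by rewrite truncn_le ltW.
have A0 : 0 <= A by rewrite addr_ge0.
have g0' := ltW g0; have E0' := ltW E0.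
rewrite [leRHS]mulrDl; apply: lerD.
  rewrite -!mulrA ler_wpM2l// exprMn -mulrA ler_wpM2l ?exprn_ge0//=.
  case: p {n nP nEg} => [|p] /=.
    rewrite !expr1 mulrCA ler_wpM2l//.
    under eq_bigr do rewrite expr1.
    apply: (le_trans (harmonic_le_ln _ D0)).
    apply: (@le_trans _ _ (A * ln g)); last
      by rewrite ler_wpM2r ?lerDl// (le_trans ler01).
    by rewrite (le_trans _ lnEg)// lerD2l ler_ln ?posrE ?ltr0n.
  (* Now [k = p + 3]: the sum is at most [zeta (p + 2)], which is at most 1 + 1 by the tail bound at
     [J = 1]. *)
  rewrite mulrC ler_wpM2r ?exprn_ge0// (@le_trans _ _ 2)// ?lerDr//.
  have /andP[_] := zeta_bounds p 1 isT (R := R).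
  have /andP[+ _] := zeta_bounds p D D0 (R := R).
  by move=> /le_trans h /h; rewrite big_nat1 !expr1n invr1.
rewrite -!mulrA ler_wpM2l ?exprn_ge0//=.
apply: (@le_trans _ _ (g * (A * ln g))); first by rewrite ler_wpM2l.
rewrite mulrCA ler_wpM2l//; case: p {n nP nEg} => [|p] //=.
(* For [k > 2] the logarithm is absorbed: [ln g < g <= g^(k-2)], since [g >= 1]. *)
rewrite exprS ler_wpM2l// (le_trans (ltW (ln_sublinear g0)))//.
by rewrite exprS ler_peMr// exprn_ege1.
Qed.
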